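(* Let $P \subset \mathbb{R}^4$ be the convex hull of the nine points $$(0,0,0,1),\ (1,0,0,1),\ (0,1,0,1),\ (0,0,1,1),\ (1,0,1,1),\ (0,1,1,1),\ (1,1,4,1),\ (1,1,5,1),\ (-1,-1,-3,-2).$$ Then $P$ is a reflexive polytope of dimension $4$ which is very ample but not normal.
   Context: A lattice polytope is a convex polytope $P \subset \mathbb{R}^d$ each of whose vertices belongs to $\mathbb{Z}^d$. A lattice polytope $P \subset \mathbb{R}^d$ of dimension $d$ is reflexive if the origin of $\mathbb{R}^d$ belongs to the interior of $P$ and the dual polytope $P^\vee = \{\mathbf{x} \in \mathbb{R}^d : \langle \mathbf{x}, \mathbf{y}\rangle \leq 1 \text{ for all } \mathbf{y} \in P\}$ is a lattice polytope, where $\langle\cdot,\cdot\rangle$ is the canonical inner product. For an integer $N \geq 1$ put $NP = \{N\mathbf{a} : \mathbf{a} \in P\}$. A lattice polytope $P \subset \mathbb{R}^d$ is normal if for each integer $N \geq 1$ and each $\mathbf{a} \in NP \cap \mathbb{Z}^d$ there exist $\mathbf{a}_1, \ldots, \mathbf{a}_N \in P \cap \mathbb{Z}^d$ with $\mathbf{a} = \mathbf{a}_1 + \cdots + \mathbf{a}_N$. It is very ample if the same holds for all sufficiently large $N$, i.e. there is $N_0$ such that for each $N \geq N_0$ and each $\mathbf{a} \in NP \cap \mathbb{Z}^d$ there exist $\mathbf{a}_1, \ldots, \mathbf{a}_N \in P \cap \mathbb{Z}^d$ with $\mathbf{a} = \mathbf{a}_1 + \cdots + \mathbf{a}_N$.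 *)

(* Defs.v *)
From mathcomp Require Import all_boot all_order all_algebra.
From mathcomp Require Import all_classical all_reals all_analysis.

Set Implicit Arguments.
Unset Strict Implicit.
Unset Printing Implicit Defensive.

Import Order.TTheory GRing.Theory Num.Theory.
Import numFieldNormedType.Exports.

Local Open Scope classical_set_scope.
Local Open Scope ring_scope.

Section Polytopes.
Variables (R : realType) (d : nat).
Implicit Types (A P : set 'rV[R]_d) (x y : 'rV[R]_d).

Definition inner x y : R := \sum_i x 0 i * y 0 i.

Definition lattice_point x : Prop := forall i, x 0 i \is a Num.int.

Definition convex_hull A : set 'rV[R]_d := smallest (@convex_set R 'rV[R]_d) A.

Definition convex_polytope P : Prop :=
  exists s : seq 'rV[R]_d, P = convex_hull [set` s].

(* [x] is a vertex of [P] when [[set x]] is a face of [P], i.e. when some linear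
   functional attains its maximum over [P] at [x] and only there. *)
Definition vertex P x : Prop :=
  P x /\ exists c, forall y, P y -> y != x -> inner c y < inner c x.

Definition lattice_polytope P : Prop :=
  convex_polytope P /\ forall x, vertex P x -> lattice_point x.

Definition affine_set A : Prop :=
  forall x y (t : R), A x -> A y -> A (t *: x + (1 - t) *: y).

Definition affine_hull A : set 'rV[R]_d := smallest affine_set A.

(* The empty set has no dimension in this sense. *)
Definition has_dim P (k : nat) : Prop :=
  exists (x : 'rV[R]_d) (U : {vspace 'rV[R]_d}),
    affine_hull P = [set x + u | u in [set` U]] /\ \dim U = k.

Definition dual P : set 'rV[R]_d :=
  [set x | forall y, P y -> inner x y <= 1].

Definition reflexive_polytope P : Prop :=
  [/\ lattice_polytope P, has_dim P d, P^° 0 & lattice_polytope (dual P)].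

Definition dilate (N : nat) P : set 'rV[R]_d := [set N%:R *: a | a in P].

Definition decomposable (N : nat) P : Prop :=
  forall a, dilate N P a -> lattice_point a ->
    exists b : 'I_N -> 'rV[R]_d,
      (forall i, P (b i) /\ lattice_point (b i)) /\ a = \sum_i b i.

Definition normal P : Prop := forall N, (1 <= N)%N -> decomposable N P.

Definition very_ample P : Prop :=
  exists N0, forall N, (N0 <= N)%N -> decomposable N P.

Definition int_point (s : seq int) : 'rV[R]_d := \row_j (s`_j)%:~R.

End Polytopes.

(* Main.v *)
Require Import Defs.
From mathcomp Require Import all_boot all_order all_algebra.
From mathcomp Require Import all_classical all_reals all_analysis.
From mathcomp Require Import zify lra ring.

Set Implicit Arguments.
Unset Strict Implicit.
Unset Printing Implicit Defensive.

Import Order.TTheory GRing.Theory Num.Theory.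
Import numFieldNormedType.Exports.

Local Open Scope ring_scope.
Local Open Scope classical_set_scope.

(** Write p_0, ..., p_8 for the nine points and Q for the hull of p_0, ..., p_7, which lies
    at height 1 and projects onto the unit square: its fibre is [0, 1] over three of the
    corners and [4, 5] over (1, 1). A lattice point (x, y, z, w) of the cone over Q is
    a sum of w of the points p_0, ..., p_7 as soon as some admissible multiplicity t of the
    corner (1, 1) satisfies 4t <= z <= 4t + w. The intervals [4t, 4t + w] leave only the hole
    h = (1, 1, 3, 2), which belongs to 2P and is not a sum of two lattice points of P.

    If a lies in NP and has height w, adding floor((N - w) / 3) copies of -p_8 and at most two of
    (0, 0, 1, 0) or (0, 0, -1, 0), which are lattice points of P, moves a into the cone
    over Q. If N >= 5 and this yields h, then at least one -p_8 was added, and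
    h + p_8 = 0 can be used instead: so P is very ample.

    The vertices of the dual of P are the nine facet normals of P; the facet of the dual
    cut out by p_8 has rectangular slices, and the dual is the pyramid over it with apex
    (0, 0, 0, 1). *)

(** * Convex hulls, affine hulls and sums of points in any dimension *)

Lemma convex_setP (R : realType) (V : lmodType R) (A : set V) :
  convex_set A <->
  forall x y t, 0 <= t <= 1 -> A x -> A y -> A (t *: x + (1 - t) *: y).
Proof.
split=> [cA x y t t01 Ax Ay|cA x y t /set_mem Ax /set_mem Ay].
  have /set_mem := cA x y (Itv01 (andP t01).1 (andP t01).2) (mem_set Ax) (mem_set Ay).
  by [].
apply/mem_set; apply: cA => //.
by apply/andP; split.
Qed.

Section Hull.
Context {R : realType} {d : nat}.
Implicit Types (A C : set 'rV[R]_d) (x y c : 'rV[R]_d).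

Lemma convex_hull_convex A : convex_set (convex_hull A).
Proof.
apply/convex_setP => x y t t01 hx hy C [cC AC].
apply: (convex_setP C).1 => //; [exact: hx | exact: hy].
Qed.

Lemma sub_convex_hull A : A `<=` convex_hull A.
Proof. exact: sub_gen_smallest. Qed.

Lemma innerC x y : inner x y = inner y x.
Proof. by apply: eq_bigr => i _; rewrite mulrC. Qed.

Lemma innerD c x y : inner c (x + y) = inner c x + inner c y.
Proof. by rewrite -big_split; apply: eq_bigr => i _; rewrite mxE mulrDr. Qed.

Lemma innerZ c t x : inner c (t *: x) = t * inner c x.
Proof. by rewrite mulr_sumr; apply: eq_bigr => i _; rewrite mxE mulrCA. Qed.

Lemma convex_hull_le A c b x :
  (forall y, A y -> inner c y <= b) -> convex_hull A x -> inner c x <= b.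
Proof.
move=> Ab hx; apply: (hx [set y | inner c y <= b]); split=> [|y]; last exact: Ab.
apply/convex_setP => y z t /andP[t0 t1] /= yb zb.
by rewrite innerD !innerZ; nra.
Qed.

(** If [x] were not in [A], then [A] would lie in the convex set where [inner c] is less than
    [inner c x], and so would [x]. *)
Lemma vertex_convex_hull A x : vertex (convex_hull A) x -> A x.
Proof.
move=> [hx [c hc]]; have [//|nAx] := pselect (A x).
suff : inner c x < inner c x by rewrite ltxx.
apply: (hx [set y | inner c y < inner c x]); split=> [|y Ay] /=.
  apply/convex_setP => y z t /andP[t0 t1] /= yb zb.
  rewrite innerD !innerZ.
  have [->|tn0] := eqVneq t 0; first lra.
  have tgt0 : 0 < t by rewrite lt0r tn0.
  nra.
apply: hc; first exact: sub_convex_hull.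
by apply/eqP => yx; apply: nAx; rewrite -yx.
Qed.

Lemma lattice_polytope_hull (s : seq 'rV[R]_d) :
  {in s, forall x, lattice_point x} -> lattice_polytope (convex_hull [set` s]).
Proof.
move=> sZ; split; first by exists s.
by move=> x /vertex_convex_hull; exact: sZ.
Qed.


Lemma convex_set_comb C (s : seq (R * 'rV[R]_d)) :
  convex_set C -> (forall p, p \in s -> 0 <= p.1 /\ C p.2) ->
  \sum_(p <- s) p.1 = 1 -> C (\sum_(p <- s) p.1 *: p.2).
Proof.
move=> /convex_setP cC Hs sum1.
(* With a nonzero total in place of the total 1, the claim passes to tails of [s]. *)
suff [y Cy ->] : exists2 y, C y &
    \sum_(p <- s) p.1 *: p.2 = (\sum_(p <- s) p.1) *: y.
  by rewrite sum1 scale1r.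
have : \sum_(p <- s) p.1 != 0 by rewrite sum1 oner_neq0.
elim: s Hs {sum1} => [|[t x] s IH] Hs; first by rewrite big_nil eqxx.
have [/= t0 Cx] := Hs _ (mem_head _ _).
have {}Hs p : p \in s -> 0 <= p.1 /\ C p.2.
  by move=> ps; apply: Hs; rewrite in_cons ps orbT.
have s0 p : p \in s -> 0 <= p.1 by move=> /Hs [].
rewrite !big_cons /=; set u := \sum_(p <- s) p.1 => tu0.
have u0 : 0 <= u by rewrite /u big_seq sumr_ge0.
have [u0'|un0] := eqVneq u 0.
  exists x => //; rewrite u0' addr0 big_seq big1 ?addr0// => p ps.
  move: u0'; rewrite /u big_seq => /eqP.
  by rewrite psumr_eq0// => /allP /(_ _ ps); rewrite ps => /eqP ->; rewrite scale0r.
have [y Cy ->] := IH Hs un0.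
exists (t / (t + u) *: x + (1 - t / (t + u)) *: y).
  apply: cC => //; rewrite divr_ge0 ?addr_ge0//=.
  by rewrite ler_pdivrMr ?mul1r ?lerDl// lt0r tu0 addr_ge0.
rewrite scalerDr !scalerA.
have E : (t + u) * (t / (t + u)) = t by rewrite mulrC divfK.
by rewrite mulrBr E mulr1 [t + u]addrC addrK.
Qed.

Lemma convex_hull_comb (s : seq 'rV[R]_d) (w : seq R) :
  size w = size s -> all (fun t => 0 <= t) w -> \sum_(t <- w) t = 1 ->
  convex_hull [set` s] (\sum_(p <- zip w s) p.1 *: p.2).
Proof.
move=> ws /allP w0 w1; apply: convex_set_comb; first exact: convex_hull_convex.
  move=> [t x] /= p_in; split.
    by apply: w0; have /= := map_f fst p_in; rewrite -/unzip1 unzip1_zip ?ws.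
  apply: sub_convex_hull => /=.
  by have /= := map_f snd p_in; rewrite -/unzip2 unzip2_zip ?ws.
by rewrite -(big_map fst xpredT id) -/unzip1 unzip1_zip ?ws.
Qed.

Lemma affine_hull_affine A : affine_set (affine_hull A).
Proof. by move=> x y t hx hy C [aC AC]; apply: (aC); [exact: hx | exact: hy]. Qed.

Lemma sub_affine_hull A : A `<=` affine_hull A.
Proof. exact: sub_gen_smallest. Qed.

(** With sequences instead of families over ['I_N], sums add by concatenation. *)
Definition sum_of A (N : nat) x : Prop :=
  exists2 s : seq 'rV[R]_d, size s = N &
    (forall y, y \in s -> A y) /\ x = \sum_(y <- s) y.

Lemma sum_ofD A M N x y : sum_of A M x -> sum_of A N y -> sum_of A (M + N) (x + y).
Proof.
move=> [s <- [sA ->]] [t <- [tA ->]]; exists (s ++ t); rewrite ?size_cat ?big_cat//.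
by split=> // z; rewrite mem_cat => /orP[/sA|/tA].
Qed.

Lemma sum_ofMn A N x : A x -> sum_of A N (N%:R *: x).
Proof.
move=> Ax; exists (nseq N x); first exact: size_nseq.
split; first by move=> y /nseqP[->].
by rewrite big_nseq -Monoid.iteropE -[iterop _ _ _ _]/(x *+ N) scaler_nat.
Qed.

Lemma decomposable_sum_of N P :
  (forall a, dilate N P a -> lattice_point a ->
     sum_of [set x | P x /\ lattice_point x] N a) -> decomposable N P.
Proof.
move=> H a aN aZ; have [s sN [sP ->]] := H a aN aZ.
exists (fun i => s`_i); rewrite (big_nth 0) sN big_mkord; split => // i.
by apply: sP; rewrite mem_nth ?sN.
Qed.

Lemma affine_set_comb A x y (s t : R) :
  affine_set A -> A 0 -> A x -> A y -> A (s *: x + t *: y).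
Proof.
move=> aA A0 Ax Ay.
have AZ u z : A z -> A (u *: z).
  by move=> Az; have := aA z 0 u Az A0; rewrite scaler0 addr0.
(* The combination is the midpoint of [2 * s *: x] and [2 * t *: y]. *)
have := aA _ _ 2^-1 (AZ (2 * s) _ Ax) (AZ (2 * t) _ Ay).
by rewrite !scalerA; congr (A (_ *: _ + _ *: _)); field.
Qed.

Lemma has_dim_full A : affine_hull A = setT -> has_dim A d.
Proof.
rewrite /has_dim => ->; exists 0, fullv; split; last by rewrite dimvf /dim /= mul1n.
by apply/seteqP; split=> // x _; exists x; rewrite ?add0r //= memvf.
Qed.

End Hull.

(** * Integer arithmetic of the cone over Q *)

(** Greedy: each part in turn takes the minimum of its capacity and what remains of [s]. *)
Lemma le_sum4_split (s a b c d : int) :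
  0 <= a -> 0 <= b -> 0 <= c -> 0 <= d -> 0 <= s -> s <= a + b + c + d ->
  exists a' b' c' d' : int, [/\ s = a' + b' + c' + d',
   0 <= a' <= a, 0 <= b' <= b, 0 <= c' <= c & 0 <= d' <= d].
Proof.
move=> a0 b0 c0 d0 s0 sle.
have step (u e : int) : 0 <= e -> 0 <= u ->
    exists f : int, 0 <= f <= e /\ f <= u /\ (u <= e -> f = u) /\ (e <= u -> f = e).
  by move=> e0 u0; case: (lerP u e) => h; [exists u|exists e]; lia.
have [a' Ha] := step s a a0 s0.
have [|b' Hb] := step (s - a') b b0; first lia.
have [|c' Hc] := step (s - a' - b') c c0; first lia.
by exists a', b', c', (s - a' - b' - c'); split; lia.
Qed.

(* Here t is the multiplicity of the corner (1, 1) of the unit square. *)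
Lemma base_cone_level (x y z w : int) :
  0 <= x -> 0 <= y -> x <= w -> y <= w -> 0 <= z -> 4 * (x + y - w) <= z ->
  z <= 4 * x + w -> z <= 4 * y + w -> ~ [/\ x = 1, y = 1, z = 3 & w = 2] ->
  exists t : int, [/\ 0 <= t, x + y - w <= t, t <= x, t <= y & 4 * t <= z <= 4 * t + w].
Proof.
move=> x0 y0 xw yw z0 z1 z2 z3 nh.
have [q [r [zE r0 r3]]] : exists q r : int, [/\ z = 4 * q + r, 0 <= r & r <= 3].
  by exists (z %/ 4)%Z, (z %% 4)%Z; split; lia.
have [xq|qx] := lerP x q.
  have [yx|xy] := lerP y x; [exists y|exists x]; split; lia.
have [yq|qy] := lerP y q; first by exists y; split; lia.
(* Only [r <= w] is left. It can fail only for [w <= 2], and then [q < x], [q < y] and the lower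
   bounds on [z] force the hole. *)
exists q; split; try lia.
have [w3|w3] := lerP 3 w; first lia.
suff : ~~ (w < r) by move=> ?; lia.
apply/negP => wr; apply: nh.
have [wE|[wE|wE]] : w = 0 \/ w = 1 \/ w = 2 by lia.
- lia.
- lia.
- by split; lia.
Qed.

(* The multiplicities k, i and j are those of p_8, (0, 0, 1, 0) and (0, 0, -1, 0). *)
Lemma reduce_to_base_cone (N : nat) (x y z w : int) :
  (5 <= N)%N ->
  w <= N%:Z -> w - z <= N%:Z -> w - 3 * y <= N%:Z -> w - 3 * x <= N%:Z ->
  4 * x + 4 * y - z - 3 * w <= N%:Z -> 3 * x - 2 * w <= N%:Z -> 3 * y - 2 * w <= N%:Z ->
  z - 4 * y <= N%:Z -> z - 4 * x <= N%:Z ->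
  exists k i j x' y' z' w' : int,
    [/\ [/\ 0 <= k, 0 <= i, 0 <= j & w' + k + i + j <= N],
     [/\ x = x' - k, y = y' - k, z = z' - 3 * k + i - j & w = w' - 2 * k],
     [/\ 0 <= x' <= w', 0 <= y' <= w' & 0 <= z'],
     [/\ 4 * (x' + y' - w') <= z', z' <= 4 * x' + w' & z' <= 4 * y' + w'] &
     ~ [/\ x' = 1, y' = 1, z' = 3 & w' = 2]].
Proof.
move=> N5 f1 f2 f3 f4 f5 f6 f7 f8 f9.
(* As [w + 3 * k = N - r], adding [k] copies of -p_8 leaves each inequality of the cone violated by
   at most [r <= 2]. For those of the unit square the defect is counted in multiples of 3, so they
   hold exactly. *)
have [k [r [E r0 r2 k0]]] : exists k r : int,
    [/\ N%:Z - w = 3 * k + r, 0 <= r, r <= 2 & 0 <= k].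
  by exists ((N%:Z - w) %/ 3)%Z, ((N%:Z - w) %% 3)%Z; split; lia.
(* In the case of the hole [N = 2 + k + r], so [5 <= N] gives [1 <= k]. *)
have [[hx hy hz hw]|nh] := pselect
    [/\ x + k = 1, y + k = 1, z + 3 * k = 3 & w + 2 * k = 2].
  by exists (k - 1), 0, 0, 0, 0, 0, 0; split; try split; try lia; case; lia.
(* The fibre of the cone goes from [l] to [4 * v + (w + 2 * k)]; if [z + 3 * k] is outside, it moves
   to the nearer end, which is never the hole. *)
have [l [l0 lL lE]] : exists l : int,
    [/\ 0 <= l, 4 * (x + y - w) <= l & l = 0 \/ l = 4 * (x + y - w)].
  by have [h|h] := lerP 0 (4 * (x + y - w));
    [exists (4 * (x + y - w))|exists 0]; split; lia.
have [v [vx vy vE]] : exists v : int,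
    [/\ v <= x + k, v <= y + k & v = x + k \/ v = y + k].
  by have [h|h] := lerP x y; [exists (x + k)|exists (y + k)]; split; lia.
have [lb|bl] := lerP l (z + 3 * k).
  have [bu|ub] := lerP (z + 3 * k) (4 * v + (w + 2 * k)).
    by exists k, 0, 0, (x + k), (y + k), (z + 3 * k), (w + 2 * k);
      split; try split; try lia.
  exists k, (z + 3 * k - (4 * v + (w + 2 * k))), 0, (x + k), (y + k),
    (4 * v + (w + 2 * k)), (w + 2 * k).
  by split; try split; try lia; case; lia.
exists k, 0, (l - (z + 3 * k)), (x + k), (y + k), l, (w + 2 * k).
by split; try split; try lia; case; lia.
Qed.

(* [n_0, ..., n_8] belong to p_0, ..., p_8, and [n9], [n10], [n11] to (0, 0, 1, 0),
   (0, 0, -1, 0) and 0. *)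
Lemma lattice_point_multiplicities (N : nat) (x y z w : int) :
  (5 <= N)%N ->
  w <= N%:Z -> w - z <= N%:Z -> w - 3 * y <= N%:Z -> w - 3 * x <= N%:Z ->
  4 * x + 4 * y - z - 3 * w <= N%:Z -> 3 * x - 2 * w <= N%:Z -> 3 * y - 2 * w <= N%:Z ->
  z - 4 * y <= N%:Z -> z - 4 * x <= N%:Z ->
  exists n0 n1 n2 n3 n4 n5 n6 n7 n8 n9 n10 n11 : nat,
    (n0 + n1 + n2 + n3 + n4 + n5 + n6 + n7 + n8 + n9 + n10 + n11 = N)%N /\
    [/\ x = n1%:Z + n4%:Z + n6%:Z + n7%:Z - n8%:Z,
     y = n2%:Z + n5%:Z + n6%:Z + n7%:Z - n8%:Z,
     z = n3%:Z + n4%:Z + n5%:Z + 4 * n6%:Z + 5 * n7%:Z - 3 * n8%:Z + n9%:Z - n10%:Z &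
     w = n0%:Z + n1%:Z + n2%:Z + n3%:Z + n4%:Z + n5%:Z + n6%:Z + n7%:Z - 2 * n8%:Z].
Proof.
move=> N5 f1 f2 f3 f4 f5 f6 f7 f8 f9.
have [k [i [j [x' [y' [z' [w'
    [[k0 i0 j0 le] [-> -> -> ->] [/andP[? ?] /andP[? ?] ?] [? ? ?] nh]]]]]]]] :=
  @reduce_to_base_cone N x y z w N5 f1 f2 f3 f4 f5 f6 f7 f8 f9.
have [//|||||//|//|//|//|t [t0 t1 t2 t3 /andP[t4 t5]]] :=
  @base_cone_level x' y' z' w'; try lia.
(* The corners (0, 0), (1, 0), (0, 1), (1, 1) have multiplicities [w' - x' - y' + t], [x' - t],
   [y' - t], [t]; of all these points, [z' - 4 * t] are upper ends of their fibres. *)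
have [|||||| n3 [n4 [n5 [n7 [E /andP[? ?] /andP[? ?] /andP[? ?] /andP[? ?]]]]]] :=
  @le_sum4_split (z' - 4 * t) (w' - x' - y' + t) (x' - t) (y' - t) t; try lia.
exists (absz (w' - x' - y' + t - n3)%R), (absz (x' - t - n4)%R),
  (absz (y' - t - n5)%R), (absz n3), (absz n4), (absz n5), (absz (t - n7)%R),
  (absz n7), (absz k), (absz i), (absz j), (absz (N%:Z - (w' + k + i + j))%R).
split; [lia | split; lia].
Qed.

(** * Coordinates in dimension 4 *)

Section Dim4.
Context {R : realType}.
Implicit Types (x y : 'rV[R]_4).

Definition vec4 (a b c d : R) : 'rV[R]_4 := \row_j [:: a; b; c; d]`_j.

Lemma vec4E x : x = vec4 (x 0 0) (x 0 1) (x 0 2) (x 0 3).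
Proof.
apply/rowP => -[[|[|[|[|//]]]] i4]; rewrite mxE /=; congr (x _ _); exact/val_inj.
Qed.

Lemma int_pointE (a b c d : int) :
  int_point R 4 [:: a; b; c; d] = vec4 a%:~R b%:~R c%:~R d%:~R.
Proof. by apply/rowP => -[[|[|[|[|//]]]] i4]; rewrite !mxE. Qed.

Lemma vec4D a b c d a' b' c' d' :
  vec4 a b c d + vec4 a' b' c' d' = vec4 (a + a') (b + b') (c + c') (d + d').
Proof. by apply/rowP => -[[|[|[|[|//]]]] i4]; rewrite !mxE. Qed.

Lemma vec4Z t a b c d : t *: vec4 a b c d = vec4 (t * a) (t * b) (t * c) (t * d).
Proof. by apply/rowP => -[[|[|[|[|//]]]] i4]; rewrite !mxE. Qed.

Lemma vec40 : vec4 0 0 0 0 = 0.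
Proof. by apply/rowP => -[[|[|[|[|//]]]] i4]; rewrite !mxE. Qed.

Lemma inner4 a b c d a' b' c' d' :
  inner (vec4 a b c d) (vec4 a' b' c' d') = a * a' + b * b' + c * c' + d * d'.
Proof. by rewrite /inner !big_ord_recr big_ord0 /= !mxE /= add0r. Qed.

Definition dot4 (u v : seq int) : int :=
  u`_0 * v`_0 + u`_1 * v`_1 + u`_2 * v`_2 + u`_3 * v`_3.

Lemma inner_int_point u v :
  inner (int_point R 4 u) (int_point R 4 v) = (dot4 u v)%:~R.
Proof.
by rewrite /inner !big_ord_recr big_ord0 /= !mxE /= add0r -!intrM -!intrD.
Qed.

Lemma lattice_int_point n u : lattice_point (int_point R n u).
Proof. by move=> i; rewrite mxE intr_int. Qed.

Lemma lattice_pointP x : lattice_point x ->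
  exists a b c d : int, x = int_point R 4 [:: a; b; c; d].
Proof.
move=> xZ; rewrite (vec4E x).
have [a ->] := intrP (xZ 0); have [b ->] := intrP (xZ 1).
have [c ->] := intrP (xZ 2); have [d ->] := intrP (xZ 3).
by exists a, b, c, d; rewrite int_pointE.
Qed.

(** Explicit weights reduce membership in a hull to scalar goals for [lra]. *)
Lemma convex_hull_vec4 (s : seq (seq int)) (w : seq R) a b c d :
  size w = size s -> all (fun t => 0 <= t) w -> \sum_(t <- w) t = 1 ->
  \sum_(p <- zip w s) p.1 * (p.2`_0)%:~R = a ->
  \sum_(p <- zip w s) p.1 * (p.2`_1)%:~R = b ->
  \sum_(p <- zip w s) p.1 * (p.2`_2)%:~R = c ->
  \sum_(p <- zip w s) p.1 * (p.2`_3)%:~R = d ->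
  convex_hull [set` map (int_point R 4) s] (vec4 a b c d).
Proof.
move=> ws w0 w1 <- <- <- <-.
have := @convex_hull_comb _ _ (map (int_point R 4) s) w.
rewrite size_map => /(_ ws w0 w1); congr convex_hull.
have -> : zip w (map (int_point R 4) s) =
    [seq (p.1, int_point R 4 p.2) | p <- zip w s].
  by elim: w s {ws w0 w1} => [|t w IH] [|v s] //=; rewrite IH.
rewrite big_map /=.
by apply/rowP => -[[|[|[|[|//]]]] i4]; rewrite mxE summxE /=;
  apply: eq_bigr => p _; rewrite !mxE.
Qed.

End Dim4.

(** * Vertices of P and of its dual, and weights on a facet of the dual *)

Definition P_vertices : seq (seq int) :=
  [:: [:: 0; 0; 0; 1]; [:: 1; 0; 0; 1]; [:: 0; 1; 0; 1]; [:: 0; 0; 1; 1];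
      [:: 1; 0; 1; 1]; [:: 0; 1; 1; 1]; [:: 1; 1; 4; 1]; [:: 1; 1; 5; 1];
      [:: -1; -1; -3; -2]].

(** The apex comes first; the other eight have product 1 with p_8. *)
Definition dual_vertices : seq (seq int) :=
  [:: [:: 0; 0; 0; 1]; [:: 0; 0; -1; 1]; [:: 0; -3; 0; 1]; [:: -3; 0; 0; 1];
      [:: 4; 4; -1; -3]; [:: 3; 0; 0; -2]; [:: 0; 3; 0; -2]; [:: 0; -4; 1; 0];
      [:: -4; 0; 1; 0]].

Lemma dot4_vertices_le1 u v :
  u \in dual_vertices -> v \in P_vertices -> dot4 u v <= 1.
Proof.
move=> uU vP; suff /allP/(_ _ uU)/allP/(_ _ vP) :
  all (fun u => all (fun v => dot4 u v <= 1) P_vertices) dual_vertices by [].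
by [].
Qed.


(* The weights of the four corners of a square, with total [mu] and marginals [alpha] and
   [beta], are determined by one of them, [t]. *)
Lemma square_split (R : realFieldType) (mu alpha beta : R) :
  0 <= alpha <= mu -> 0 <= beta <= mu ->
  exists t, [/\ 0 <= t, t <= alpha, t <= beta & alpha + beta - mu <= t].
Proof.
move=> /andP[a0 a1] /andP[b0 b1].
by have [h|h] := lerP 0 (alpha + beta - mu);
  [exists (alpha + beta - mu)|exists 0]; split; lra.
Qed.

(** Here [s] runs over the Minkowski sum of [[0, 8 * la]], from an edge, and [[- 3 * mu, 3 * mu]],
    from the square. *)
Lemma segment_split (R : realFieldType) (la mu s : R) :
  0 <= la -> 0 <= mu -> - (3 * mu) <= s <= 3 * mu + 8 * la ->
  exists theta alpha, [/\ 0 <= theta <= la, 0 <= alpha <= mu &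
    s = 8 * theta + 3 * (2 * alpha - mu)].
Proof.
move=> l0 m0 /andP[s0 s1]; have [h|h] := lerP s (3 * mu).
  by exists 0, ((s + 3 * mu) / 6); split; lra.
by exists ((s - 3 * mu) / 8), mu; split; lra.
Qed.

(* The facet of the dual on which <x, p_8> = m is the hull of a square
   (c = 0) and two segments (c = -1 and c = 1); each half is handled with [segment_split] and
   [square_split] in the coordinates a + b and a - b. *)
Lemma dual_facet_weights (R : realType) (a b c d m : R) :
  m = - a - b - 3 * c - 2 * d ->
  d <= m -> a + d <= m -> b + d <= m -> c + d <= m -> a + c + d <= m ->
  b + c + d <= m -> a + b + 4 * c + d <= m -> a + b + 5 * c + d <= m ->
  exists w1 w2 w3 w4 w5 w6 w7 w8 : R,
    [&& 0 <= w1, 0 <= w2, 0 <= w3, 0 <= w4, 0 <= w5, 0 <= w6, 0 <= w7 & 0 <= w8] /\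
    [/\ w1 + w2 + w3 + w4 + w5 + w6 + w7 + w8 = m,
        a = - 3 * w3 + 4 * w4 + 3 * w5 - 4 * w8,
        b = - 3 * w2 + 4 * w4 + 3 * w6 - 4 * w7,
        c = - w1 - w4 + w7 + w8 &
        d = w1 + w2 + w3 - 3 * w4 - 2 * w5 - 2 * w6].
Proof.
move=> mE g0 g1 g2 g3 g4 g5 g6 g7; have [c0|c0] := lerP c 0.
  (* On the edge at c = -1, a + b runs from 0 to 8 and a - b is 0; on the square both run from -3 to
     3. *)
  have [|||th [al [thl alm sE]]] := @segment_split R (- c) (m + c) (a + b); try lra.
  have [||t [t0 ta tb abt]] :=
    @square_split R (m + c) al ((a - b + 3 * (m + c)) / 6); try lra.
  exists (- c - th), ((a - b + 3 * (m + c)) / 6 - t),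
    (m + c - al - (a - b + 3 * (m + c)) / 6 + t), th, t, (al - t), 0, 0.
  by split; [lra | split; lra].
(* The shift by [4 * c] makes a - b run from 0 to 8 and a + b vanish on the edge at c = 1. *)
have [|||th [be [thl bem sE]]] := @segment_split R c (m - c) (a - b + 4 * c); try lra.
have [||t [t0 ta tb abt]] :=
  @square_split R (m - c) ((a + b + 4 * c + 3 * (m - c)) / 6) be; try lra.
exists 0, (be - t), (m - c - be - (a + b + 4 * c + 3 * (m - c)) / 6 + t), 0, t,
  ((a + b + 4 * c + 3 * (m - c)) / 6 - t), th, (c - th).
by split; [lra | split; lra].
Qed.

(** * Interior, dual, affine hull and lattice decompositions of P *)

Section P.
Context {R : realType}.
Implicit Types (x y : 'rV[R]_4).

Let P : set 'rV[R]_4 := convex_hull [set` map (int_point R 4) P_vertices].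

Lemma P_inner_le1 x u : P x -> u \in dual_vertices -> inner (int_point R 4 u) x <= 1.
Proof.
move=> Px uU; apply: convex_hull_le Px => _ /mapP[v vP ->].
by rewrite inner_int_point -[1]/(1%:~R) ler_int dot4_vertices_le1.
Qed.

Lemma P_vertex v : v \in P_vertices -> P (int_point R 4 v).
Proof. by move=> vP; apply: sub_convex_hull; exact: (map_f (int_point R 4) vP). Qed.

(** Barycentre of p_3, p_7, p_8. *)
Lemma P_e3 : P (int_point R 4 [:: 0; 0; 1; 0]).
Proof.
rewrite int_pointE.
apply: (@convex_hull_vec4 _ _ [:: 0; 0; 0; 3^-1; 0; 0; 0; 3^-1; 3^-1]);
  rewrite ?big_cons ?big_nil //=; lra.
Qed.

(** Barycentre of p_1, p_2, p_8. *)
Lemma P_Ne3 : P (int_point R 4 [:: 0; 0; -1; 0]).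
Proof.
rewrite int_pointE.
apply: (@convex_hull_vec4 _ _ [:: 0; 3^-1; 3^-1; 0; 0; 0; 0; 0; 3^-1]);
  rewrite ?big_cons ?big_nil //=; lra.
Qed.

(** Half of the hole h is the barycentre of p_0, p_4, p_5, p_6. *)
Lemma P_half_hole : P (vec4 2^-1 2^-1 (3 / 2) 1).
Proof.
apply: (@convex_hull_vec4 _ _ [:: 4^-1; 0; 0; 0; 4^-1; 4^-1; 4^-1; 0; 0]);
  rewrite ?big_cons ?big_nil //=; lra.
Qed.

(* Barycentric coordinates in the simplex p_0 p_4 p_5 p_6 p_8, where
   p_0 + p_4 + p_5 + p_6 + 2 p_8 = 0. *)
Lemma P_nbhs0 a b c d : `|a| < 30^-1 -> `|b| < 30^-1 -> `|c| < 30^-1 ->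
  `|d| < 30^-1 -> P (vec4 a b c d).
Proof.
rewrite !ltr_norml => /andP[a1 a2] /andP[b1 b2] /andP[c1 c2] /andP[d1 d2].
pose n8 := (1 - d) / 3; pose n6 := (c - a - b + n8) / 2.
apply: (@convex_hull_vec4 _ _ [:: 1 - n8 - n6 - (a + n8 - n6) - (b + n8 - n6);
    0; 0; 0; a + n8 - n6; b + n8 - n6; n6; 0; n8]);
  rewrite ?big_cons ?big_nil //= /n6 /n8; lra.
Qed.

Lemma P0 : P 0.
Proof. by rewrite -vec40; apply: P_nbhs0; rewrite normr0 invr_gt0. Qed.

Lemma P_interior0 : P^° 0.
Proof.
apply/nbhs_ballP; exists 30^-1; first by rewrite /= invr_gt0.
move=> x [_ bx]; rewrite (vec4E x).
have H i : `|x 0 i| < 30^-1.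
  by have := bx 0 i; rewrite /ball /= mxE sub0r normrN.
exact: P_nbhs0.
Qed.

Lemma dual_P : dual P = convex_hull [set` map (int_point R 4) dual_vertices].
Proof.
apply/seteqP; split=> x.
  move=> Dx.
  have {}Dx v : v \in P_vertices -> inner x (int_point R 4 v) <= 1.
    by move=> vP; apply: Dx; exact: P_vertex.
  move: Dx; rewrite (vec4E x).
  move: (x 0 0) (x 0 1) (x 0 2) (x 0 3) => a b c d H.
  have := H [:: 0; 0; 0; 1] erefl; have := H [:: 1; 0; 0; 1] erefl.
  have := H [:: 0; 1; 0; 1] erefl; have := H [:: 0; 0; 1; 1] erefl.
  have := H [:: 1; 0; 1; 1] erefl; have := H [:: 0; 1; 1; 1] erefl.
  have := H [:: 1; 1; 4; 1] erefl; have := H [:: 1; 1; 5; 1] erefl.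
  have := H [:: -1; -1; -3; -2] erefl.
  rewrite !int_pointE !inner4 => g8 g7 g6 g5 g4 g3 g2 g1 g0 {H}.
  (* [k] is the weight of the apex: once it is removed, the product with p_8 equals the remaining
     weight [1 - k]. *)
  have [k kE] : exists k, 3 * k = 1 + a + b + 3 * c + 2 * d.
    by exists ((1 + a + b + 3 * c + 2 * d) / 3); lra.
  have [|||||||||w1 [w2 [w3 [w4 [w5 [w6 [w7 [w8 [w0 [wm wa wb wc wd]]]]]]]]]] :=
    @dual_facet_weights R a b c (d - k) (- a - b - 3 * c - 2 * (d - k)); try lra.
  apply: (@convex_hull_vec4 _ _ [:: k; w1; w2; w3; w4; w5; w6; w7; w8]);
    rewrite ?big_cons ?big_nil //=; lra.
move=> hx y Py; rewrite innerC; apply: convex_hull_le hx => _ /mapP[u uU ->].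
by rewrite innerC P_inner_le1.
Qed.

Lemma P_affine_hull : affine_hull P = setT.
Proof.
apply/seteqP; split=> // x _.
have PA v : v \in P_vertices -> affine_hull P (int_point R 4 v).
  by move=> vP; apply: sub_affine_hull; apply: P_vertex.
have aP := @affine_hull_affine R 4 P.
have A0 := sub_affine_hull P0.
have A3 := sub_affine_hull P_e3.
have comb := fun y z s t => @affine_set_comb R 4 _ y z s t aP A0.
(* The affine hull contains 0, so it is linear, and p_1, p_2, (0, 0, 1, 0), p_0 form a basis. *)
have -> : x =
    1 *: (x 0 0 *: int_point R 4 [:: 1; 0; 0; 1] +
          x 0 1 *: int_point R 4 [:: 0; 1; 0; 1]) +
    1 *: (x 0 2 *: int_point R 4 [:: 0; 0; 1; 0] +
          (x 0 3 - x 0 0 - x 0 1) *: int_point R 4 [:: 0; 0; 0; 1]).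
  rewrite {1}(vec4E x) !int_pointE !(vec4Z, vec4D); congr vec4; ring.
by apply: (comb); apply: (comb) => //; apply: PA.
Qed.

Lemma P_dilate_ineq N (x y z w : int) : dilate N P (int_point R 4 [:: x; y; z; w]) ->
  forall u, u \in dual_vertices -> dot4 u [:: x; y; z; w] <= N%:Z.
Proof.
move=> [p Pp pE] u uU; rewrite -(ler_int R) -inner_int_point -pE innerZ.
by rewrite -[leRHS]mulr1 ler_wpM2l ?P_inner_le1.
Qed.

Lemma P_very_ample : very_ample P.
Proof.
exists 5 => N N5; apply: decomposable_sum_of => a aN aZ.
have [x [y [z [w aE]]]] := lattice_pointP aZ; move: aN; rewrite aE.
move=> /P_dilate_ineq H.
have := H [:: 0; 0; 0; 1] erefl; have := H [:: 0; 0; -1; 1] erefl.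
have := H [:: 0; -3; 0; 1] erefl; have := H [:: -3; 0; 0; 1] erefl.
have := H [:: 4; 4; -1; -3] erefl; have := H [:: 3; 0; 0; -2] erefl.
have := H [:: 0; 3; 0; -2] erefl; have := H [:: 0; -4; 1; 0] erefl.
have := H [:: -4; 0; 1; 0] erefl; rewrite /dot4 /= => {H} h9 h8 h7 h6 h5 h4 h3 h2 h1.
have [|||||||||n0 [n1 [n2 [n3 [n4 [n5 [n6 [n7 [n8 [n9 [n10 [n11
    [<- [-> -> -> ->]]]]]]]]]]]]]] :=
  @lattice_point_multiplicities N x y z w N5; try lia.
pose A : set 'rV[R]_4 := [set x | P x /\ lattice_point x].
have PA v n : P (int_point R 4 v) -> sum_of A n (n%:R *: int_point R 4 v).
  by move=> Pv; apply: sum_ofMn; split=> //; exact: lattice_int_point.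
have VA v n : v \in P_vertices -> sum_of A n (n%:R *: int_point R 4 v).
  move=> vP; apply: PA; exact: P_vertex.
(* Copies of 0 pad the sum to exactly [N] terms. *)
have A0 n : sum_of A n (n%:R *: int_point R 4 [:: 0; 0; 0; 0]).
  by apply: PA; rewrite int_pointE vec40; exact: P0.
have -> : int_point R 4 [:: n1%:Z + n4%:Z + n6%:Z + n7%:Z - n8%:Z;
     n2%:Z + n5%:Z + n6%:Z + n7%:Z - n8%:Z;
     n3%:Z + n4%:Z + n5%:Z + 4 * n6%:Z + 5 * n7%:Z - 3 * n8%:Z + n9%:Z - n10%:Z;
     n0%:Z + n1%:Z + n2%:Z + n3%:Z + n4%:Z + n5%:Z + n6%:Z + n7%:Z - 2 * n8%:Z] =
  n0%:R *: int_point R 4 [:: 0; 0; 0; 1] + n1%:R *: int_point R 4 [:: 1; 0; 0; 1] +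
  n2%:R *: int_point R 4 [:: 0; 1; 0; 1] + n3%:R *: int_point R 4 [:: 0; 0; 1; 1] +
  n4%:R *: int_point R 4 [:: 1; 0; 1; 1] + n5%:R *: int_point R 4 [:: 0; 1; 1; 1] +
  n6%:R *: int_point R 4 [:: 1; 1; 4; 1] + n7%:R *: int_point R 4 [:: 1; 1; 5; 1] +
  n8%:R *: int_point R 4 [:: -1; -1; -3; -2] + n9%:R *: int_point R 4 [:: 0; 0; 1; 0] +
  n10%:R *: int_point R 4 [:: 0; 0; -1; 0] + n11%:R *: int_point R 4 [:: 0; 0; 0; 0].
  rewrite !int_pointE !(vec4Z, vec4D); congr vec4; ring.
do !apply: sum_ofD; try exact: A0; try exact: VA.
- by apply: PA; exact: P_e3.
- by apply: PA; exact: P_Ne3.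
Qed.

Lemma P_not_normal : ~ normal P.
Proof.
move=> /(_ 2 isT (int_point R 4 [:: 1; 1; 3; 2])) [||b [bP]].
- exists (vec4 2^-1 2^-1 (3 / 2) 1); first exact: P_half_hole.
  by rewrite int_pointE vec4Z; congr vec4; lra.
- exact: lattice_int_point.
rewrite !big_ord_recr big_ord0 /= add0r.
move: (bP (widen_ord (leqnSn 1) ord_max)) (bP ord_max).
move: (b _) (b _) => p q [Pp /lattice_pointP [x [y [z [w pE]]]]]
  [Pq /lattice_pointP [x' [y' [z' [w' qE]]]]].
rewrite pE qE !int_pointE vec4D => /rowP E.
have := E 0; have := E 1; have := E 2; have := E 3; rewrite !mxE /= -!intrD.
move=> /intr_inj E3 /intr_inj E2 /intr_inj E1 /intr_inj E0.
have dil a : P a -> dilate 1 P a by exists a; rewrite ?scale1r.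
have Hp := P_dilate_ineq (dil _ (eq_ind _ P Pp _ pE)).
have Hq := P_dilate_ineq (dil _ (eq_ind _ P Pq _ qE)).
(* Both heights are 1, so the summands lie over opposite corners of the square. Their third
   coordinates add up to at least 4 over (0, 0) and (1, 1), and to at most 2 over (1, 0) and (0, 1),
   never to 3. *)
move: (Hp [:: 0; 0; 0; 1] erefl) (Hp [:: 0; 0; -1; 1] erefl)
  (Hp [:: 0; -3; 0; 1] erefl) (Hp [:: -3; 0; 0; 1] erefl)
  (Hp [:: 4; 4; -1; -3] erefl) (Hp [:: 0; -4; 1; 0] erefl) (Hp [:: -4; 0; 1; 0] erefl).
move: (Hq [:: 0; 0; 0; 1] erefl) (Hq [:: 0; 0; -1; 1] erefl)
  (Hq [:: 0; -3; 0; 1] erefl) (Hq [:: -3; 0; 0; 1] erefl)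
  (Hq [:: 4; 4; -1; -3] erefl) (Hq [:: 0; -4; 1; 0] erefl) (Hq [:: -4; 0; 1; 0] erefl).
rewrite /dot4 /= => *.
lia.
Qed.

End P.

Theorem lemma1p1 (R : realType) :
  let P : set 'rV[R]_4 :=
    convex_hull [set` [:: int_point R 4 [:: 0; 0; 0; 1];
                          int_point R 4 [:: 1; 0; 0; 1];
                          int_point R 4 [:: 0; 1; 0; 1];
                          int_point R 4 [:: 0; 0; 1; 1];
                          int_point R 4 [:: 1; 0; 1; 1];
                          int_point R 4 [:: 0; 1; 1; 1];
                          int_point R 4 [:: 1; 1; 4; 1];
                          int_point R 4 [:: 1; 1; 5; 1];
                          int_point R 4 [:: -1; -1; -3; -2]]] in
  [/\ reflexive_polytope P, has_dim P 4, very_ample P & ~ normal P].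
Proof.
have lattice_hull (s : seq (seq int)) :
    lattice_polytope (convex_hull [set` map (int_point R 4) s]).
  by apply: lattice_polytope_hull => _ /mapP[v _ ->]; exact: lattice_int_point.
have dimP := has_dim_full (@P_affine_hull R).
split=> //; [split=> // | exact: P_very_ample | exact: P_not_normal].
- exact: (lattice_hull P_vertices).
- exact: P_interior0.
- by have := @dual_P R; rewrite /= => ->; exact: (lattice_hull dual_vertices).
Qed.
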